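(* Let $\rho>0$. Consider the hierarchical optimization problem over a tree network with $D$ levels, written in layered form as $\min \sum_{d=1}^D f_d(x_d)$ subject to $A_dx_d+B_dx_{d+1}=c_d$ for $d=1,\dots,D-1$, where $f_d,A_d,B_d,c_d$ are built from the tree as described in the context. Assume that the problem has a strictly feasible point (Slater's condition) and admits an optimal solution. Suppose that $f_1,\dots,f_D$ are proper, lower semicontinuous and convex, that $A_1$ has full column rank, and that $B_1,\dots,B_{D-1}$ have full column rank. Let $\{([x_d^k]_{d=1}^{D},[y_d^k]_{d=1}^{D-1})\}_k$ be the sequence generated by the hADMM algorithm with penalty parameter $\rho$. Then: (i) the sequence $\{([x_d^k]_{d=1}^{D},[y_d^k]_{d=1}^{D-1})\}_k$ is bounded; (ii) the primal residuals $r_d^{k}=A_dx_d^{k}+B_dx_{d+1}^{k}-c_d$ satisfy $r_d^k\to 0$ as $k\to\infty$ for all $d\in\{1,\dots,D-1\}$; (iii) every cluster point of the sequence belongs to the KKT set $\mathcal O^\star$. If, in addition, $\mathcal O^\star$ is a singleton, then the whole sequence converges to the unique point $([x_d^\star]_{d=1}^{D},[y_d^\star]_{d=1}^{D-1})$ of $\mathcal O^\star$.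
   Context: **Tree problem.** A rooted tree has levels $d=1,\dots,D$ ($D\ge 2$); node $(d,i)$ is the $i$-th node at level $d$, and $(1,1)$ is the only node at level 1 (the root). Each non-root node at level $d+1$ has exactly one parent, at level $d$. $\mathcal C_{d,i}$ is the set of indices $j$ such that $(d+1,j)$ is a child of $(d,i)$; $\mathcal P_d$ is the index set of nodes at level $d$ with at least one child (parents) and $\mathcal L_d$ the index set of nodes at level $d$ with no child (leaves). Node $(d,i)$ has a variable $x_{d,i}\in\mathbb R^{n_{d,i}}$ and a finite-valued convex cost $f_{d,i}:\mathbb R^{n_{d,i}}\to\mathbb R$. The hierarchical optimization problem minimizes $\sum_{d=1}^D\sum_{i\in\mathcal P_d\cup\mathcal L_d}f_{d,i}(x_{d,i})$ subject to $A_{d,ij}x_{d,i}+B_{d,ij}x_{d+1,j}=c_{d,ij}$ for all $d\in\{1,\dots,D-1\}$, $i\in\mathcal P_d$, $j\in\mathcal C_{d,i}$, with given $A_{d,ij}\in\mathbb R^{s_{d,ij}\times n_{d,i}}$, $B_{d,ij}\in\mathbb R^{s_{d,ij}\times n_{d+1,j}}$, $c_{d,ij}\in\mathbb R^{s_{d,ij}}$. **Layered form.** $x_d\in\mathbb R^{n_d}$ stacks all $x_{d,i}$, $i\in\mathcal P_d$, followed by all $x_{d,i}$, $i\in\mathcal L_d$; $f_d(x_d)=\sum_{i\in\mathcal P_d\cup\mathcal L_d}f_{d,i}(x_{d,i})$. For $i\in\mathcal P_d$, $A_{d,i}$ is the vertical stack of $A_{d,ij}$, $j\in\mathcal C_{d,i}$;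 $B_{d,i}$ is the block-diagonal matrix of $B_{d,ij}$, $j\in\mathcal C_{d,i}$; $c_{d,i}$ is the stack of $c_{d,ij}$. Then $A_d=[\mathrm{blockdiag}(A_{d,i})_{i\in\mathcal P_d},\ 0]\in\mathbb R^{s_d\times n_d}$, $B_d=\mathrm{blockdiag}(B_{d,i})_{i\in\mathcal P_d}M_d\in\mathbb R^{s_d\times n_{d+1}}$, $c_d$ is the stack of $c_{d,i}$, $i\in\mathcal P_d$, where $s_d=\sum_{i\in\mathcal P_d}\sum_{j\in\mathcal C_{d,i}}s_{d,ij}$ and $M_d$ is the permutation matrix with $[[x_{d+1,j}]_{j\in\mathcal C_{d,i}}]_{i\in\mathcal P_d}=M_dx_{d+1}$. The tree problem is exactly the layered problem in the claim. **hADMM.** The augmented Lagrangian is $$L(x_1,\dots,x_D;y_1,\dots,y_{D-1})=f_D(x_D)+\sum_{d=1}^{D-1}\Big(f_d(x_d)+y_d^\top(A_dx_d+B_dx_{d+1}-c_d)+\tfrac{\rho}{2}\|A_dx_d+B_dx_{d+1}-c_d\|_2^2\Big),$$ with $y_d\in\mathbb R^{s_d}$. From an arbitrary initial point $([x_d^0]_d,[y_d^0]_d)$, iteration $k$ ($k=0,1,2,\dots$, run without stopping) computes, for $d=1,2,\dots,D$ in this order (forward pass), $$x_d^{k+1}=\arg\min_{x_d}L(x_1^{k+1},\dots,x_{d-1}^{k+1},x_d,x_{d+1}^k,\dots,x_D^k;y_1^k,\dots,y_{D-1}^k),$$ and then (backward pass) $y_d^{k+1}=y_d^k+\rho(A_dx_d^{k+1}+B_dx_{d+1}^{k+1}-c_d)$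 for $d=D-1,\dots,1$. (The paper's Algorithm 1 is a distributed implementation of these passes over the tree.) **KKT set.** $\mathcal O^\star$ is the set of all $([x_d^\star]_{d=1}^D,[y_d^\star]_{d=1}^{D-1})$ satisfying $0\in\partial f_1(x_1^\star)+A_1^\top y_1^\star$; $0\in\partial f_D(x_D^\star)+B_{D-1}^\top y_{D-1}^\star$; $0\in\partial f_d(x_d^\star)+A_d^\top y_d^\star+B_{d-1}^\top y_{d-1}^\star$ for $d=2,\dots,D-1$; and $A_dx_d^\star+B_dx_{d+1}^\star=c_d$ for $d=1,\dots,D-1$. Here $\partial f$ denotes the convex subdifferential. *)

(* Defs.v *)
From HB Require Import structures.
From mathcomp Require Import all_boot all_order all_algebra.
From mathcomp Require Import all_classical all_reals all_analysis.

Set Implicit Arguments.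
Unset Strict Implicit.
Unset Printing Implicit Defensive.

Import Order.TTheory GRing.Theory Num.Theory.
Import numFieldNormedType.Exports.

Local Open Scope classical_set_scope.
Local Open Scope ring_scope.

(* Conventions.  Levels are numbered from 0 (the root) to D.-1, so level d here
   is level d+1 in 1-based numbering, and constraint d, for d.+1 < D, couples
   levels d and d.+1.  Vectors are column vectors.  Families indexed by levels
   are total functions on nat: a tree has no node at a level d >= D, hence all
   blocks of the layered form beyond the last level (last constraint) live in
   R^0 and carry no information (level_dim_eq0, level_rows_eq0).  Topologies on
   infinite families therefore reduce to those on the finitely many blocks. *)

Section ConvexAnalysis.
Variable R : realType.

Definition dotv n (u v : 'cV[R]_n) : R := (u^T *m v) 0 0.

(* Squared Euclidean norm; `|u| is the sup norm of the library. *)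
Definition sqnorm2 n (u : 'cV[R]_n) : R := dotv u u.

Definition subdifferential n (f : 'cV[R]_n -> R) (x : 'cV[R]_n) :
    set 'cV[R]_n :=
  [set g | forall z, f x + dotv g (z - x) <= f z].

Definition effective_domain (T : Type) (f : T -> \bar R) : set T :=
  [set x | (f x < +oo)%E].

Definition proper_function (T : Type) (f : T -> \bar R) : Prop :=
  effective_domain f !=set0 /\ forall x, (-oo < f x)%E.

Definition argmin (T : Type) (f : T -> R) : set T :=
  [set x | forall z, f x <= f z].

End ConvexAnalysis.

Definition blockdiag (R : nmodType) p (r_ c_ : 'I_p -> nat)
    (F : forall i, 'M[R]_(r_ i, c_ i)) : 'M[R]_(\sum_i r_ i, \sum_i c_ i) :=
  \mxblock_(i < p, j < p) (if i == j then conform_mx 0 (F i) else 0).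

Section Layered.
Variables (R : realType) (D : nat).

Record layered := Layered {
  xdim : nat -> nat;
  ydim : nat -> nat;
  fL : forall d, 'cV[R]_(xdim d) -> R;
  AL : forall d, 'M[R]_(ydim d, xdim d);
  BL : forall d, 'M[R]_(ydim d, xdim d.+1);
  cL : forall d, 'cV[R]_(ydim d) }.

Variable P : layered.

Definition primal_space : Type := prod_topology (fun d => 'cV[R]_(xdim P d)).
Definition dual_space : Type := prod_topology (fun d => 'cV[R]_(ydim P d)).

Implicit Types (x : primal_space) (y : dual_space).

Definition residual x d : 'cV[R]_(ydim P d) :=
  AL P d *m x d + BL P d *m x d.+1 - cL P d.

Definition objective x : R := \sum_(d < D) fL (x d).

Definition feasible x : Prop :=
  forall d, (d.+1 < D)%N -> AL P d *m x d + BL P d *m x d.+1 = cL P d.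

Definition optimal x : Prop :=
  feasible x /\ forall x', feasible x' -> objective x <= objective x'.

(* Slater's point.  The only explicit constraints are equalities, so strictness
   bears on the domains; these are full-dimensional since the costs are
   finite-valued, hence interior and relative interior agree. *)
Definition strictly_feasible x : Prop :=
  feasible x /\
  forall d, (d < D)%N -> interior (effective_domain (EFin \o @fL P d)) (x d).

Definition lagrangian (rho : R) x y : R :=
  fL (x D.-1) +
  \sum_(d < D.-1) (fL (x d) + dotv (y d) (residual x d)
                   + rho / 2 * sqnorm2 (residual x d)).

(* The point (x_0^new, .., x_(d-1)^new, w, x_(d+1)^old, ..). *)
Definition sweep (xnew xold : primal_space) d (w : 'cV[R]_(xdim P d)) : primal_space :=
  dfwith (fun e => if (e < d)%N then xnew e else xold e) d w.

Definition hadmm (rho : R) (z : nat -> primal_space * dual_space) : Prop :=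
  forall k,
    (forall d, (d < D)%N ->
       argmin (fun w : 'cV[R]_(xdim P d) =>
                 lagrangian rho (sweep (z k.+1).1 (z k).1 w) (z k).2)
              ((z k.+1).1 d)) /\
    (forall d, (d.+1 < D)%N ->
       (z k.+1).2 d = (z k).2 d + rho *: residual (z k.+1).1 d).

(* Meant for D >= 2; the three stationarity conditions are those of the root,
   of the last level, and of the intermediate levels. *)
Definition kkt_set : set (primal_space * dual_space) :=
  [set z | let x := z.1 in let y := z.2 in
    [/\ [set g + (AL P 0%N)^T *m y 0%N | g in subdifferential (@fL P 0%N) (x 0%N)] 0,
        forall d, d.+2 = D ->
          [set g + (BL P d)^T *m y d
            | g in subdifferential (@fL P d.+1) (x d.+1)] 0,
        forall d, (d.+2 < D)%N ->
          [set g + (AL P d.+1)^T *m y d.+1 + (BL P d)^T *m y d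
            | g in subdifferential (@fL P d.+1) (x d.+1)] 0
      & forall d, (d.+1 < D)%N ->
          AL P d *m x d + BL P d *m x d.+1 = cL P d]].

End Layered.

Arguments kkt_set {R} D P _.

Record tree (D : nat) := Tree {
  width : nat -> nat;
  width_root : width 0%N = 1%N;
  width_gt0 : forall d, (0 < width d)%N = (d < D)%N;
  parent : forall d, 'I_(width d.+1) -> 'I_(width d) }.

Section TreeNodes.
Variables (D : nat) (T : tree D).

Definition children d (i : 'I_(width T d)) : {set 'I_(width T d.+1)} :=
  [set j | parent j == i]%SET.

Definition parents d : {set 'I_(width T d)} :=
  [set i | children i != finset.set0]%SET.

Definition leaves d : {set 'I_(width T d)} :=
  [set i | children i == finset.set0]%SET.

End TreeNodes.

(* The constraint data are indexed by all pairs (i, j) of nodes of consecutive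
   levels; only the entries with j \in children i are ever used. *)
Record tree_problem (R : realType) (D : nat) (T : tree D) := TreeProblem {
  ndim : forall d, 'I_(width T d) -> nat;
  sdim : forall d, 'I_(width T d) -> 'I_(width T d.+1) -> nat;
  cost : forall d (i : 'I_(width T d)), 'cV[R]_(ndim i) -> R;
  cost_convex : forall d (i : 'I_(width T d)),
    @convex_function R 'cV[R]_(ndim i) setT (@cost d i);
  Aedge : forall d (i : 'I_(width T d)) (j : 'I_(width T d.+1)),
    'M[R]_(sdim i j, ndim i);
  Bedge : forall d (i : 'I_(width T d)) (j : 'I_(width T d.+1)),
    'M[R]_(sdim i j, ndim j);
  cedge : forall d (i : 'I_(width T d)) (j : 'I_(width T d.+1)),
    'cV[R]_(sdim i j) }.

Section LayeredForm.
Variables (R : realType) (D : nat) (T : tree D) (Q : tree_problem R T).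
Local Notation n_ := (ndim Q).
Local Notation s_ := (sdim Q).

Definition node_at (I : finType) (S : {set I}) (k : 'I_#|S|) : I := enum_val k.

Definition level_dim d : nat :=
  (\sum_(k < #|parents T d|) n_ (node_at k)
   + \sum_(k < #|leaves T d|) n_ (node_at k))%N.

Definition stack d (x : forall i : 'I_(width T d), 'cV[R]_(n_ i)) :
    'cV[R]_(level_dim d) :=
  col_mx (\mxcol_(k < #|parents T d|) x (node_at k))
         (\mxcol_(k < #|leaves T d|) x (node_at k)).

Definition eq_block d (i j : 'I_(width T d)) : 'M[R]_(n_ i, n_ j) :=
  if i == j then conform_mx 0 (1%:M : 'M[R]_(n_ i)) else 0.

(* 0/1 matrix selecting the block x_(d,i) of the stacked vector x_d. *)
Definition select d (i : 'I_(width T d)) : 'M[R]_(n_ i, level_dim d) :=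
  row_mx (\mxrow_(k < #|parents T d|) eq_block i (node_at k))
         (\mxrow_(k < #|leaves T d|) eq_block i (node_at k)).

Definition node_rows d (i : 'I_(width T d)) : nat :=
  (\sum_(l < #|children i|) s_ i (node_at l))%N.

Definition node_cols d (i : 'I_(width T d)) : nat :=
  (\sum_(l < #|children i|) n_ (node_at l))%N.

Definition level_rows d : nat :=
  (\sum_(k < #|parents T d|) node_rows (node_at k))%N.

Definition Anode d (i : 'I_(width T d)) : 'M[R]_(node_rows i, n_ i) :=
  \mxcol_(l < #|children i|) Aedge Q i (node_at l).

Definition Bnode d (i : 'I_(width T d)) : 'M[R]_(node_rows i, node_cols i) :=
  blockdiag (fun l : 'I_#|children i| => Bedge Q i (node_at l)).

Definition cnode d (i : 'I_(width T d)) : 'cV[R]_(node_rows i) :=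
  \mxcol_(l < #|children i|) cedge Q i (node_at l).

(* Permutation matrix taking x_(d+1), listed as parents then leaves, to the
   same blocks grouped by the parent at level d; see reorder_stack. *)
Definition reorder d :
    'M[R]_(\sum_(k < #|parents T d|) node_cols (node_at k), level_dim d.+1) :=
  \mxcol_(k < #|parents T d|)
    \mxcol_(l < #|children (node_at k)|) select (node_at l).

Definition Alevel d : 'M[R]_(level_rows d, level_dim d) :=
  row_mx (blockdiag (fun k : 'I_#|parents T d| => Anode (node_at k))) 0.

Definition Blevel d : 'M[R]_(level_rows d, level_dim d.+1) :=
  blockdiag (fun k : 'I_#|parents T d| => Bnode (node_at k)) *m reorder d.

Definition clevel d : 'cV[R]_(level_rows d) :=
  \mxcol_(k < #|parents T d|) cnode (node_at k).

Definition flevel d (x : 'cV[R]_(level_dim d)) : R :=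
  \sum_(i < width T d) cost (select i *m x).

Definition layered_form : layered R :=
  Layered flevel Alevel Blevel clevel.

End LayeredForm.

Section LayeredFormTheory.
Variables (R : realType) (D : nat) (T : tree D) (Q : tree_problem R T).
Local Notation n_ := (ndim Q).

Lemma eq_block_mul d (i j : 'I_(width T d))
    (x : forall i : 'I_(width T d), 'cV[R]_(n_ i)) :
  eq_block Q i j *m x j = if i == j then x i else 0.
Proof.
rewrite /eq_block; case: eqP => [<-|_]; last by rewrite mul0mx.
by rewrite conform_mx_id mul1mx.
Qed.

Lemma sum_node_at (I : finType) (S : {set I}) (V : nmodType) (F : I -> V) :
  \sum_(k < #|S|) F (node_at k) = \sum_(i in S) F i.
Proof. by rewrite -big_enum_val. Qed.

Lemma leavesE d : leaves T d = (~: parents T d)%SET.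
Proof. by apply/setP => i; rewrite !inE negbK. Qed.

(* stack and select are mutually inverse, so layered vectors are exactly the
   stacked families of node variables. *)
Lemma select_stack d (x : forall i : 'I_(width T d), 'cV[R]_(n_ i)) i :
  select Q i *m stack x = x i.
Proof.
rewrite /select /stack mul_row_col !mul_mxrow_mxcol.
under eq_bigr do rewrite eq_block_mul.
under [X in _ + X]eq_bigr do rewrite eq_block_mul.
rewrite (sum_node_at (parents T d) (fun j => if i == j then x i else 0)).
rewrite (sum_node_at (leaves T d) (fun j => if i == j then x i else 0)).
rewrite leavesE [X in _ + X](eq_bigl (fun j => j \notin parents T d));
  last by move=> j; rewrite inE.
rewrite -(bigID (mem (parents T d)) xpredT) /=.
by rewrite -big_mkcond (big_pred1 i).
Qed.

Lemma reorder_stack d (x : forall i : 'I_(width T d.+1), 'cV[R]_(n_ i)) :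
  reorder Q d *m stack x =
  \mxcol_(k < #|parents T d|)
    \mxcol_(l < #|children (node_at k)|) x (node_at l).
Proof.
rewrite /reorder mxcol_mul; apply: eq_mxcol => k.
by rewrite mxcol_mul; apply: eq_mxcol => l; rewrite select_stack.
Qed.

Lemma blockdiag_mul p (r_ c_ : 'I_p -> nat)
    (F : forall i, 'M[R]_(r_ i, c_ i)) (x : forall i, 'cV[R]_(c_ i)) :
  blockdiag F *m \mxcol_i x i = \mxcol_i (F i *m x i).
Proof.
rewrite /blockdiag mxblockEv mxcol_mul; apply: eq_mxcol => i.
rewrite mul_mxrow_mxcol (bigD1 i) //= eqxx conform_mx_id big1 ?addr0 // => j.
by rewrite eq_sym => /negbTE->; rewrite mul0mx.
Qed.

Lemma Alevel_stack d (x : forall i : 'I_(width T d), 'cV[R]_(n_ i)) :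
  Alevel Q d *m stack x = \mxcol_(k < #|parents T d|)
    \mxcol_(l < #|children (node_at k)|)
      (Aedge Q (node_at k) (node_at l) *m x (node_at k)).
Proof.
rewrite /Alevel /stack mul_row_col mul0mx addr0 blockdiag_mul.
by apply: eq_mxcol => k; rewrite mxcol_mul.
Qed.

Lemma Blevel_stack d (x : forall i : 'I_(width T d.+1), 'cV[R]_(n_ i)) :
  Blevel Q d *m stack x = \mxcol_(k < #|parents T d|)
    \mxcol_(l < #|children (node_at k)|)
      (Bedge Q (node_at k) (node_at l) *m x (node_at l)).
Proof.
rewrite /Blevel -mulmxA reorder_stack blockdiag_mul.
by apply: eq_mxcol => k; rewrite blockdiag_mul.
Qed.

(* With flevel_stack: the layered problem is the tree problem. *)
Lemma constraint_stack d (x : forall d (i : 'I_(width T d)), 'cV[R]_(n_ i)) :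
  Alevel Q d *m stack (x d) + Blevel Q d *m stack (x d.+1) = clevel Q d <->
  forall (i : 'I_(width T d)) j, j \in children i ->
    Aedge Q i j *m x d i + Bedge Q i j *m x d.+1 j = cedge Q i j.
Proof.
rewrite Alevel_stack Blevel_stack -mxcolD /clevel /cnode; split.
- move=> /(iffRL (eq_mxcolP _ _)) H i j ij.
  have iP : i \in parents T d by rewrite inE; apply/set0Pn; exists j.
  have := H (enum_rank_in iP i); rewrite /node_at enum_rankK_in // -mxcolD.
  move=> /(iffRL (eq_mxcolP _ _)) /(_ (enum_rank_in ij j)).
  by rewrite /node_at enum_rankK_in.
- move=> H; apply: eq_mxcol => k; rewrite -mxcolD; apply: eq_mxcol => l.
  by apply: H; exact: enum_valP.
Qed.

Lemma flevel_stack d (x : forall i : 'I_(width T d), 'cV[R]_(n_ i)) :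
  flevel (stack x) = \sum_i cost (x i).
Proof. by apply: eq_bigr => i _; rewrite select_stack. Qed.

Lemma eq_block_sum d (S : {set 'I_(width T d)})
    (w : 'cV[R]_(\sum_(k < #|S|) n_ (node_at k))) k :
  \sum_(l < #|S|) eq_block Q (node_at k) (node_at l) *m submxcol w l =
  submxcol w k.
Proof.
rewrite (bigD1 k) //= big1 => [|l lk].
  by rewrite addr0 /eq_block eqxx conform_mx_id mul1mx.
by rewrite /eq_block (inj_eq enum_val_inj) eq_sym (negbTE lk) mul0mx.
Qed.

Lemma eq_block_sum0 d (S S' : {set 'I_(width T d)})
    (w : 'cV[R]_(\sum_(k < #|S'|) n_ (node_at k))) (k : 'I_#|S|) :
  fintype.disjoint (mem S) (mem S') ->
  \sum_(l < #|S'|) eq_block Q (node_at k) (node_at l) *m submxcol w l = 0.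
Proof.
move=> dis; rewrite big1 // => l _.
rewrite /eq_block; case: eqP => [e|_]; last by rewrite mul0mx.
have := enum_valP k; rewrite (disjointFl dis) //.
by rewrite -/(node_at k) e; exact: enum_valP.
Qed.

Lemma stack_select d (w : 'cV[R]_(level_dim Q d)) :
  stack (fun i => select Q i *m w) = w.
Proof.
have dis : fintype.disjoint (mem (parents T d)) (mem (leaves T d)).
  by rewrite leavesE finset.disjoints_subset finset.setCK.
have dis' : fintype.disjoint (mem (leaves T d)) (mem (parents T d)).
  by rewrite disjoint_sym.
rewrite -[RHS]vsubmxK /stack -[usubmx w in RHS]submxcolK -[dsubmx w in RHS]submxcolK.
by congr col_mx; apply: eq_mxcol => k; rewrite -{1}[w]vsubmxK /select mul_row_col
  -[usubmx w in LHS]submxcolK -[dsubmx w in LHS]submxcolK !mul_mxrow_mxcol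
  eq_block_sum eq_block_sum0 // ?addr0 ?add0r.
Qed.

Lemma level_dim_eq0 d : (D <= d)%N -> level_dim Q d = 0%N.
Proof.
move=> Dd; have w0 : width T d = 0%N.
  by apply/eqP; rewrite -leqn0 leqNgt width_gt0 -leqNgt.
have no_node (i : 'I_(width T d)) : n_ i = 0%N.
  by case: i => m lm; have : (m < 0)%N by rewrite -w0.
by rewrite /level_dim !big1.
Qed.

Lemma level_rows_eq0 d : (D <= d.+1)%N -> level_rows Q d = 0%N.
Proof.
move=> Dd; have w0 : width T d.+1 = 0%N.
  by apply/eqP; rewrite -leqn0 leqNgt width_gt0 -leqNgt.
apply: big1 => k _; have := enum_valP k; rewrite inE => /set0Pn[[m lm] _].
by have : (m < 0)%N by rewrite -w0.
Qed.

End LayeredFormTheory.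

(* Main.v *)
(* Writing r_d for the residuals, b_d^k = B_d (x_(d+1)^(k+1) - x_(d+1)^k) and Y
   for y^(k+1), optimality of x_d^(k+1) reads
     0 \in \partial f_d(x_d^(k+1)) + A_d^T (Y_d - rho b_d^k) + B_(d-1)^T Y_(d-1).
   Tested against a saddle point (xs, ys), this makes
     V_k = \sum_d |y_d^k - ys_d|^2 + rho^2 |B_d (x_(d+1)^k - xs_(d+1))|^2
   decrease by at least rho^2 \sum_d |r_d^(k+1) - b_d^k|^2, because the terms
   decouple over the constraints exactly as in two-block ADMM.  To separate r_d
   from b_d, use monotonicity of \partial f_(d+1) between two consecutive
   iterates: up to terms involving only r_(d+1) and b_(d+1) it bounds
   <b_d, r_d> above by 0, so r_d, b_d --> 0 by induction from the last level up
   to the root.  The multipliers ys come from an elementary separation argument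
   that adds the scalar constraints one at a time. *)
Require Import Defs.
From mathcomp Require Import all_boot all_order all_algebra.
From mathcomp Require Import all_classical all_reals all_analysis.
From mathcomp Require Import ring lra.

Set Implicit Arguments.
Unset Strict Implicit.
Unset Printing Implicit Defensive.

Import Order.TTheory GRing.Theory Num.Theory.
Import numFieldNormedType.Exports.

Local Open Scope classical_set_scope.
Local Open Scope ring_scope.

(** * Euclidean inner product and squared norm *)

Section DotProduct.
Context {R : realType}.

Lemma dotvE n (u v : 'cV[R]_n) : dotv u v = \sum_i u i 0 * v i 0.
Proof. by rewrite /dotv mxE; apply: eq_bigr => i _; rewrite mxE. Qed.

Lemma dotvC n (u v : 'cV[R]_n) : dotv u v = dotv v u.
Proof. by rewrite !dotvE; apply: eq_bigr => i _; rewrite mulrC. Qed.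

Lemma dotvDl n (u v w : 'cV[R]_n) : dotv (u + v) w = dotv u w + dotv v w.
Proof. by rewrite /dotv linearD/= mulmxDl mxE. Qed.

Lemma dotvZl n a (u v : 'cV[R]_n) : dotv (a *: u) v = a * dotv u v.
Proof. by rewrite /dotv linearZ/= -scalemxAl mxE. Qed.

Lemma dotvDr n (u v w : 'cV[R]_n) : dotv u (v + w) = dotv u v + dotv u w.
Proof. by rewrite /dotv mulmxDr mxE. Qed.

Lemma dotvZr n a (u v : 'cV[R]_n) : dotv u (a *: v) = a * dotv u v.
Proof. by rewrite dotvC dotvZl dotvC. Qed.

Lemma dotvNl n (u v : 'cV[R]_n) : dotv (- u) v = - dotv u v.
Proof. by rewrite -scaleN1r dotvZl mulN1r. Qed.

Lemma dotvNr n (u v : 'cV[R]_n) : dotv u (- v) = - dotv u v.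
Proof. by rewrite -scaleN1r dotvZr mulN1r. Qed.

Lemma dotv0l n (u : 'cV[R]_n) : dotv 0 u = 0.
Proof. by rewrite -(scale0r 0) dotvZl mul0r. Qed.

Lemma dotv0r n (u : 'cV[R]_n) : dotv u 0 = 0.
Proof. by rewrite dotvC dotv0l. Qed.

Lemma col_dim0 n (u v : 'cV[R]_n) : n = 0%N -> u = v.
Proof. by move=> n0; move: u v; rewrite n0 => u v; apply/matrixP => -[]. Qed.

Lemma dotv_adjoint m n (A : 'M[R]_(m, n)) (u : 'cV[R]_m) (v : 'cV[R]_n) :
  dotv u (A *m v) = dotv (A^T *m u) v.
Proof. by rewrite /dotv trmx_mul trmxK mulmxA. Qed.

Definition dotvP := (dotvDl, dotvDr, dotvNl, dotvNr, dotvZl, dotvZr).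

Lemma sqnorm2_ge0 n (u : 'cV[R]_n) : 0 <= sqnorm2 u.
Proof. by rewrite /sqnorm2 dotvE; apply: sumr_ge0 => i _; rewrite -expr2 sqr_ge0. Qed.

Lemma sqr_coord_le n (u : 'cV[R]_n) i : u i 0 ^+ 2 <= sqnorm2 u.
Proof.
rewrite /sqnorm2 dotvE (bigD1 i)//= expr2 lerDl.
by apply: sumr_ge0 => j _; rewrite -expr2 sqr_ge0.
Qed.

(* For dl = y^(k+1) - ys, s = r^(k+1), U = B (x^(k+1) - xs), c = b^k and a = rho,
   this is one summand of V_k - V_(k+1) - rho^2 |r^(k+1) - b^k|^2. *)
Lemma lyapunov_identity n a (dl s U c : 'cV[R]_n) :
  sqnorm2 (dl - a *: s) + a ^+ 2 * sqnorm2 (U - c)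
  - (sqnorm2 dl + a ^+ 2 * sqnorm2 U) - a ^+ 2 * sqnorm2 (s - c) =
  2 * a * (a * dotv c (s - U) - dotv dl s).
Proof.
rewrite /sqnorm2 !dotvP [dotv s dl]dotvC [dotv c U]dotvC [dotv c s]dotvC.
by ring.
Qed.

End DotProduct.

(** * First-order optimality from convexity *)

Section Convexity.
Context {R : realType}.

Lemma convex_functionE n (f : 'cV[R]_n -> R) :
  @convex_function R 'cV[R]_n setT f ->
  forall t u v, 0 <= t <= 1 ->
    f (t *: u + (1 - t) *: v) <= t * f u + (1 - t) * f v.
Proof.
move=> cf t u v t01.
have := cf (Itv01 (proj1 (andP t01)) (proj2 (andP t01))) u v.
by rewrite !inE; exact.
Qed.

(** Convexity bounds [f (x + t *: v) - f x] by [t * (f (x + v) - f x)], so after division by [t] the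
    quadratic term is negligible for small [t]. An exact minimisation with quadratic penalty thus
    yields a first-order inequality. *)
Lemma convex_min_linearized n (f : 'cV[R]_n -> R) (x v : 'cV[R]_n) a b :
  @convex_function R 'cV[R]_n setT f ->
  (forall t, f x <= f (x + t *: v) + t * a + t ^+ 2 * b) ->
  f x <= f (x + v) + a.
Proof.
move=> /convex_functionE cf fmin; rewrite leNgt; apply/negP => gap.
set c := f x - (f (x + v) + a).
have c0 : 0 < c by rewrite /c; lra.
have b0 : 0 < `|b| + 1 by rewrite ltr_wpDl.
(* Small enough that [t * b] stays below the supposed gap [c]; the [+ 1] keeps the denominator
   positive when [b = 0]. *)
set t := Num.min 1 (c / (2 * (`|b| + 1))).
have t0 : 0 < t by rewrite /t lt_min ltr01/= divr_gt0// mulr_gt0.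
have t1 : t <= 1 by rewrite /t ge_min lexx.
have tb : t * b < c.
  have tc : t * (2 * (`|b| + 1)) <= c.
    by rewrite -ler_pdivlMr ?mulr_gt0// /t ge_min lexx orbT.
  have := ler_norm b; nra.
have := cf t (x + v) x; rewrite (ltW t0) t1 => /(_ isT).
have -> : t *: (x + v) + (1 - t) *: x = x + t *: v.
  by rewrite scalerDr scalerBl scale1r addrC addrA subrK.
move=> ft; have := fmin t; rewrite /c in tb c0 *; nra.
Qed.

End Convexity.

(** * Lagrange multipliers for affine constraints by separation *)

Section Multipliers.
Context {R : realType} {V : Type}.
(* comb t u v stands for t u + (1 - t) v; no law of it is needed.  Affine maps
   and sets are tested on all real t, not only on [0, 1]. *)
Variable comb : R -> V -> V -> V.

Definition affine_closed (W : set V) :=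
  forall t u v, W u -> W v -> W (comb t u v).

Definition affine_map m (L : V -> 'cV[R]_m) :=
  forall t u v, L (comb t u v) = t *: L u + (1 - t) *: L v.

Definition comb_convex (p : V -> R) :=
  forall t u v, 0 <= t <= 1 -> p (comb t u v) <= t * p u + (1 - t) * p v.

Lemma scalar_multiplier (W : set V) (p l : V -> R) (w0 : V) :
  affine_closed W -> comb_convex p ->
  (forall t u v, l (comb t u v) = t * l u + (1 - t) * l v) ->
  W w0 -> l w0 = 0 -> (forall v, W v -> l v = 0 -> 0 <= p v) ->
  exists a, forall v, W v -> a * l v <= p v.
Proof.
(* A convex combination of points of {l < 0} and {l > 0} lies on {l = 0}, so the
   slopes p / l on {l < 0} are bounded by those on {l > 0}; take their supremum
   for a.  Reflection through w0 (t = 2) exchanges the two sides. *)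
move=> Wcomb pconv laff Ww0 lw0 p0.
have cross u v : W u -> W v -> l u < 0 -> 0 < l v -> p u / l u <= p v / l v.
  move=> Wu Wv lu lv; set t := l v / (l v - l u).
  have D0 : 0 < l v - l u by lra.
  have t0 : 0 <= t by rewrite divr_ge0// ltW.
  have t1 : t <= 1 by rewrite ler_pdivrMr//; lra.
  have ltE : t * (l v - l u) = l v by rewrite divfK// gt_eqF.
  have l0 : l (comb t u v) = 0 by rewrite laff; nra.
  have := pconv t u v; rewrite t0 t1 => /(_ isT).
  have := p0 _ (Wcomb t _ _ Wu Wv) l0 => h0 h1.
  rewrite ler_ndivrMr// mulrAC ler_pdivrMr//.
  have : 0 <= (t * p u + (1 - t) * p v) * (l v - l u).
    by rewrite mulr_ge0 ?(le_trans h0 h1)// ltW.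
  rewrite (_ : _ * _ = p u * (t * (l v - l u))
    + p v * (l v - l u - t * (l v - l u))); last by ring.
  by rewrite ltE; lra.
(* Without a point of negative [l], reflection through [w0] rules out positive values too; then
   [l = 0] on [W] and [a = 0] works. *)
have [[u0 [Wu0 lu0]]|neg0] := pselect (exists u, W u /\ l u < 0); last first.
  exists 0 => v Wv; rewrite mul0r p0//; apply/eqP; rewrite eq_le.
  rewrite [X in _ && X]leNgt; apply/andP; split; last first.
    by apply/negP => lv; apply: neg0; exists v.
  rewrite leNgt; apply/negP => lv; apply: neg0; exists (comb 2 w0 v).
  by split; [exact: Wcomb|rewrite laff lw0; lra].
have Wv0 : W (comb 2 w0 u0) by exact: Wcomb.
have lv0 : 0 < l (comb 2 w0 u0) by rewrite laff lw0; lra.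
pose E := [set p u / l u | u in [set u | W u /\ l u < 0]].
have E0 : E !=set0 by exists (p u0 / l u0); exists u0.
have Eub : has_ubound E.
  exists (p (comb 2 w0 u0) / l (comb 2 w0 u0)).
  by move=> _ [u [Wu lu] <-]; exact: cross.
exists (sup E) => v Wv; have [lv|lv|lv] := ltgtP (l v) 0.
- by rewrite -ler_ndivrMr//; apply: ub_le_sup => //; exists v.
- rewrite -ler_pdivlMr//; apply: ge_sup => // _ [u [Wu lu] <-].
  exact: cross.
- by rewrite lv mulr0 p0.
Qed.

(** Induction on the number of coordinates. The slice of [W] where the first coordinate [l] vanishes
    is again closed under [comb], and the induction hypothesis gives multipliers for the other
    coordinates there. Subtracting their term from [p] leaves a convex function, nonnegative on the
    slice, and [scalar_multiplier] provides the coefficient of [l]. *)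
Lemma vector_multiplier m (W : set V) (p : V -> R) (L : V -> 'cV[R]_m) (w0 : V) :
  affine_closed W -> comb_convex p -> affine_map L ->
  W w0 -> L w0 = 0 -> (forall v, W v -> L v = 0 -> 0 <= p v) ->
  exists lam : 'cV[R]_m, forall v, W v -> dotv lam (L v) <= p v.
Proof.
elim: m W p L => [|m IH] W p L Wcomb pconv Laff Ww0 Lw0 p0.
  by exists 0 => v Wv; rewrite dotv0l p0//; apply/matrixP => -[].
pose l v := L v 0 0; pose L' v := dsubmx (L v : 'cV_(1 + m)).
have laff t u v : l (comb t u v) = t * l u + (1 - t) * l v.
  by rewrite /l Laff !mxE.
have L'aff : affine_map L'.
  by move=> t u v; rewrite /L' Laff !linearD/= !linearZ.
have LE v : L v = col_mx (l v)%:M (L' v).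
  have <- : usubmx (L v : 'cV_(1 + m)) = (l v)%:M.
    by apply/matrixP => i j; rewrite !ord1 !mxE; congr (L v _ _); apply: val_inj.
  by rewrite /L' (@vsubmxK _ 1 m).
have l0 : l w0 = 0 by rewrite /l Lw0 mxE.
have L'0 : L' w0 = 0 by rewrite /L' Lw0 linear0.
have [lam' lam'P] : exists lam, forall v, W v /\ l v = 0 -> dotv lam (L' v) <= p v.
  apply: (IH (W `&` [set v | l v = 0])) => //.
  - move=> t u v [Wu lu] [Wv lv]; split; first exact: Wcomb.
    by rewrite /= laff lu lv !mulr0 addr0.
  - move=> v [Wv /= lv] L'v; apply: p0 => //; rewrite LE lv L'v.
    by rewrite -scalemx1 scale0r col_mx0.
have [a aP] : exists a, forall v, W v -> a * l v <= p v - dotv lam' (L' v).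
  apply: (@scalar_multiplier W _ l w0) => //.
  - move=> t u v t01; rewrite L'aff !dotvP.
    have := pconv t u v t01; nra.
  - by move=> v Wv lv; rewrite subr_ge0 lam'P.
exists (col_mx a%:M lam') => v /aP; rewrite LE /dotv.
rewrite (tr_col_mx a%:M lam') (mul_row_col a%:M^T) tr_scalar_mx -scalar_mxM.
have -> (N : 'M[R]_1) : ((a * l v)%:M + N) 0 0 = a * l v + N 0 0.
  by rewrite !mxE mulr1n.
by rewrite -/(dotv lam' (L' v)); lra.
Qed.

End Multipliers.

(** * Limits, boundedness and compactness for column vectors *)

Section ColumnConvergence.
Context {R : realType}.

Lemma coord_le_norm n (u : 'cV[R]_n) i : `|u i 0| <= `|u|.
Proof.
rewrite {2}/Num.norm/= mx_normrE.
exact: (le_bigmax _ (fun ij : 'I_n * 'I_1 => `|u ij.1 ij.2|) (i, 0)).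
Qed.

Lemma norm_le_coord n (u : 'cV[R]_n) M : 0 <= M ->
  (forall i, `|u i 0| <= M) -> `|u| <= M.
Proof.
move=> M0 uM; rewrite /Num.norm/= mx_normrE.
by apply/bigmax_leP; split => // -[i j] _ /=; rewrite ord1.
Qed.

Section Filter.
Context {T : Type} {F : set_system T} {FF : Filter F}.

Lemma cvg_colP n (u : T -> 'cV[R]_n) (a : 'cV[R]_n) :
  (forall i, u t i 0 @[t --> F] --> a i 0) -> u @ F --> a.
Proof.
move=> ua; apply/cvgrPdist_lt => e e0.
have e20 : 0 < e / 2 by rewrite divr_gt0.
have : \forall t \near F, forall i, `|a i 0 - u t i 0| < e / 2.
  apply: filter_forall => i; by have /cvgrPdist_lt := ua i; apply.
apply: filterS => t ut; apply: (@le_lt_trans _ _ (e / 2)).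
  apply: norm_le_coord => [|i]; first exact: ltW.
  by rewrite !mxE; exact: ltW (ut i).
by rewrite ltr_pdivrMr// ltr_pMr// ltr1n.
Qed.

Lemma cvg_dim0 n (u : T -> 'cV[R]_n) (a : 'cV[R]_n) : n = 0%N -> u @ F --> a.
Proof.
by move=> n0; apply: cvg_colP => -[i ni]; exfalso; move: ni; rewrite n0.
Qed.

Lemma cvg_coord n (u : T -> 'cV[R]_n) (a : 'cV[R]_n) i :
  u @ F --> a -> u t i 0 @[t --> F] --> a i 0.
Proof.
by move=> ua; exact: (cvg_comp _ _ ua (@coord_continuous _ _ _ i 0 a)).
Qed.

Lemma cvg0D n (u v : T -> 'cV[R]_n) : u @ F --> (0 : 'cV[R]_n) ->
  v @ F --> (0 : 'cV[R]_n) -> u t + v t @[t --> F] --> (0 : 'cV[R]_n).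
Proof. by move=> u0 v0; have := cvgD u0 v0; rewrite addr0; exact. Qed.

Lemma cvg0B n (u v : T -> 'cV[R]_n) : u @ F --> (0 : 'cV[R]_n) ->
  v @ F --> (0 : 'cV[R]_n) -> u t - v t @[t --> F] --> (0 : 'cV[R]_n).
Proof. by move=> u0 v0; have := cvgB u0 v0; rewrite subr0; exact. Qed.

Lemma cvg_mulmx m n (A : 'M[R]_(m, n)) (u : T -> 'cV[R]_n) a :
  u @ F --> a -> A *m u t @[t --> F] --> A *m a.
Proof.
move=> ua; apply: cvg_colP => i; rewrite mxE; under eq_fun do rewrite mxE.
apply: cvg_big => [|j _]; first exact: add_continuous.
by apply: cvgM; [exact: cvg_cst|exact: cvg_coord].
Qed.

Lemma cvg_dotv n (u v : T -> 'cV[R]_n) (a b : 'cV[R]_n) :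
  u @ F --> a -> v @ F --> b -> dotv (u t) (v t) @[t --> F] --> dotv a b.
Proof.
move=> ua vb; rewrite dotvE; under eq_fun do rewrite dotvE.
apply: cvg_big => [|j _]; first exact: add_continuous.
by apply: cvgM; exact: cvg_coord.
Qed.

Lemma cvg_sqnorm2_0 n (u : T -> 'cV[R]_n) :
  sqnorm2 (u t) @[t --> F] --> (0 : R) -> u @ F --> (0 : 'cV[R]_n).
Proof.
move=> u0; apply: cvg_colP => i; rewrite mxE; apply/cvgr0Pnorm_lt => e e0.
have /cvgr0Pnorm_lt/(_ (e ^+ 2)) := u0; rewrite exprn_gt0// => /(_ isT).
apply: filterS => t; rewrite ger0_norm ?sqnorm2_ge0// => ut.
rewrite -(@ltr_pXn2r _ 2)// ?nnegrE ?normr_ge0 ?ltW//.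
by rewrite real_normK ?num_real//; exact: le_lt_trans (sqr_coord_le _ _) ut.
Qed.

End Filter.

Definition bounded_seq n (u : nat -> 'cV[R]_n) :=
  exists M, forall k, `|u k| <= M.

Lemma bounded_seqD n (u v : nat -> 'cV[R]_n) :
  bounded_seq u -> bounded_seq v -> bounded_seq (fun k => u k + v k).
Proof.
move=> [M uM] [N vN]; exists (M + N) => k.
by rewrite (le_trans (ler_normD _ _))// lerD.
Qed.

Lemma bounded_seq_cst n (a : 'cV[R]_n) : bounded_seq (fun=> a).
Proof. by exists `|a|. Qed.

Lemma bounded_seqB n (u v : nat -> 'cV[R]_n) :
  bounded_seq u -> bounded_seq v -> bounded_seq (fun k => u k - v k).
Proof.
move=> bu [N vN]; apply: bounded_seqD bu _.
by exists N => k; rewrite normrN.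
Qed.

Lemma bounded_seqZ n a (u : nat -> 'cV[R]_n) :
  bounded_seq u -> bounded_seq (fun k => a *: u k).
Proof. by move=> [M uM]; exists (`|a| * M) => k; rewrite normrZ ler_wpM2l. Qed.

Lemma bounded_seq_mulmx m n (A : 'M[R]_(m, n)) (u : nat -> 'cV[R]_n) :
  bounded_seq u -> bounded_seq (fun k => A *m u k).
Proof.
move=> [M uM]; have M0 : 0 <= M by exact: le_trans (normr_ge0 _) (uM 0%N).
exists (\sum_i \sum_j `|A i j| * M) => k; apply: norm_le_coord => [|i].
  by apply: sumr_ge0 => i _; apply: sumr_ge0 => j _; rewrite mulr_ge0.
rewrite (bigD1 i)//= ler_wpDr//.
  by apply: sumr_ge0 => l _; apply: sumr_ge0 => j _; rewrite mulr_ge0.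
rewrite mxE (le_trans (ler_norm_sum _ _ _))//; apply: ler_sum => j _.
by rewrite normrM ler_wpM2l// (le_trans (coord_le_norm _ _)).
Qed.

Lemma bounded_seq_dim0 n (u : nat -> 'cV[R]_n) : n = 0%N -> bounded_seq u.
Proof. by move=> n0; exists `|u 0%N| => k; rewrite (col_dim0 (u k) (u 0%N)). Qed.

Lemma bounded_seq_shift n (u : nat -> 'cV[R]_n) :
  bounded_seq (fun k => u k.+1) -> bounded_seq u.
Proof.
move=> [M uM]; exists (Num.max `|u 0%N| M) => -[|k]; first by rewrite le_max lexx.
by rewrite le_max uM orbT.
Qed.

Lemma bounded_seq_sqnorm2 n (u : nat -> 'cV[R]_n) C :
  (forall k, sqnorm2 (u k) <= C) -> bounded_seq u.
Proof.
move=> uC; have C0 : 0 <= C by exact: le_trans (sqnorm2_ge0 _) (uC 0%N).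
exists (1 + C) => k; apply: norm_le_coord => [|i]; first lra.
rewrite -(@ler_pXn2r _ 2)// ?nnegrE ?normr_ge0//; last lra.
rewrite real_normK ?num_real// (le_trans (sqr_coord_le _ _))//.
by rewrite (le_trans (uC k))//; nra.
Qed.

(** Full column rank gives [A] a left inverse, which carries the bounded images back to [u]. *)
Lemma bounded_seq_full_rank m n (A : 'M[R]_(m, n)) (u : nat -> 'cV[R]_n) :
  \rank A = n -> bounded_seq (fun k => A *m u k) -> bounded_seq u.
Proof.
move=> rA /(bounded_seq_mulmx (pinvmx A^T)^T).
have fA : row_free A^T by rewrite /row_free mxrank_tr rA.
have AK : (pinvmx A^T)^T *m A = 1%:M.
  by rewrite -{2}[A]trmxK -trmx_mul mulmxVp// trmx1.
by under eq_fun do rewrite mulmxA AK mul1mx.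
Qed.

Lemma cvg0_dotv_bounded n (u v : nat -> 'cV[R]_n) :
  u @ \oo --> (0 : 'cV[R]_n) -> bounded_seq v ->
  dotv (u k) (v k) @[k --> \oo] --> (0 : R).
Proof.
move=> u0 [M vM]; under eq_fun do rewrite dotvE.
suff : \sum_i u k i 0 * v k i 0 @[k --> \oo] --> \sum_(i < n) (0 : R).
  by rewrite big1.
apply: cvg_big => [|i _]; first exact: add_continuous.
have := cvg_coord (i := i) u0; rewrite mxE => ui0.
have uM0 : u k i 0 * M @[k --> \oo] --> (0 : R).
  by rewrite -(mul0r M); exact: cvgM ui0 (cvg_cst _).
apply/cvgr0Pnorm_lt => e e0.
have /cvgr0Pnorm_lt/(_ e e0) := uM0; apply: filterS => k; apply: le_lt_trans.
rewrite !normrM ler_wpM2l// (le_trans (coord_le_norm _ _))//.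
exact: le_trans (vM k) (ler_norm M).
Qed.

Lemma compact_coord_box n M :
  compact [set v : 'cV[R]_n | forall i, `|v i 0| <= M].
Proof.
have -> : [set v : 'cV[R]_n | forall i, `|v i 0| <= M] =
    trmx @` [set u : 'rV[R]_n | forall i, `[- M, M]%classic (u 0 i)].
  apply/seteqP; split => [v vM|_ [u uM <-] i].
    by exists v^T; rewrite ?trmxK// => i; rewrite /= mxE in_itv/= -ler_norml.
  by rewrite mxE ler_norml; have := uM i; rewrite /= in_itv.
apply: continuous_compact; last first.
  exact: (@rV_compact R n (fun=> `[- M, M]%classic) (fun=> @segment_compact _ _ _)).
apply: continuous_subspaceT => u.
apply: (@cvg_colP _ (nbhs u) _) => i.
by rewrite mxE; under eq_fun do rewrite mxE; exact: coord_continuous.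
Qed.

End ColumnConvergence.

(** If some neighbourhood [U] of [a] is not in [F], the trace of [F] on the complement of [U] is
    still proper. Compactness gives it a cluster point, which also clusters [F], hence equals [a];
    but [U] misses the trace. *)
Lemma compact_cvg_cluster1 (T : topologicalType) (F : set_system T)
    (K : set T) (a : T) :
  ProperFilter F -> compact K -> F K -> cluster F `<=` [set a] -> F --> a.
Proof.
move=> PF cK FK clF U aU; apply: contrapT => nFU.
have PG : ProperFilter (within (~` U) F).
  apply: Build_ProperFilter => FU; apply: nFU.
  by apply: (@filterS _ F _ _ _ _ FU) => t tU; exact: contrapT.
have [//|q [Kq clq]] := cK (within (~` U) F) PG.
  by apply: (@filterS _ F _ _ _ _ FK) => t Kt _.
have qa : q = a.
  apply: clF => A B FA; apply: clq.
  by apply: (@filterS _ F _ _ _ _ FA) => t At _.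
have UG : within (~` U) F (~` U) by exact: withinT.
have qU : nbhs q U by rewrite qa.
by have [t [nUt /nUt]] := clq _ U UG qU.
Qed.

(** Passes an asymptotic inequality to a cluster point without extracting a subsequence: were
    [phi p] positive, lower semicontinuity would keep [phi] above [phi p / 2] near [p], where the
    sequence must return although its values are eventually below. *)
Lemma cluster_le0 (R : realType) (T : topologicalType) (u : nat -> T) (p : T)
    (phi : T -> R) :
  cluster (u @ \oo) p ->
  (forall a, a < phi p -> \forall q \near p, a < phi q) ->
  (forall e, 0 < e -> \forall k \near \oo, phi (u k) <= e) -> phi p <= 0.
Proof.
move=> clp lsc lim; rewrite leNgt; apply/negP => p0.
have e0 : 0 < phi p / 2 by rewrite divr_gt0.
have lt_p : phi p / 2 < phi p by lra.
have [q [/= qe]] := clp [set q | phi q <= phi p / 2] _ (lim _ e0) (lsc _ lt_p).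
by rewrite ltNge qe.
Qed.

(** * Saddle points of the layered problem *)

Section LayeredProblem.
Context {R : realType} {D : nat} {P : layered R}.
Hypothesis D0 : (0 < D)%N.
Hypothesis ydim0 : forall d, (D <= d.+1)%N -> ydim P d = 0%N.
Hypothesis fconv : forall d, (d < D)%N ->
  @convex_function R 'cV[R]_(xdim P d) setT (@fL R P d).

Implicit Types (x w : primal_space P) (y q : dual_space P).

(** Refers to the Lagrangian without penalty. Its saddle inequality in the dual variable is an
    equality once all residuals of [x] vanish. *)
Definition saddle x y := (forall d, residual x d = 0) /\
  forall w, objective D x <=
    objective D w + \sum_(d < D.-1) dotv (y d) (residual w d).

Definition primal_comb (t : R) x w : primal_space P :=
  fun d => t *: x d + (1 - t) *: w d.

Lemma residual_affine d :
  affine_map primal_comb (fun x : primal_space P => residual x d).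
Proof.
move=> t u v; rewrite /residual /primal_comb !mulmxDr -!scalemxAr.
move: (AL P d *m u d) (AL P d *m v d) (BL P d *m u _) (BL P d *m v _).
by move=> ? ? ? ?; apply/matrixP => i j; rewrite !mxE; ring.
Qed.

Lemma objective_convex x0 :
  comb_convex primal_comb (fun x : primal_space P => objective D x - objective D x0).
Proof.
move=> t u v t01.
have : objective D (primal_comb t u v) <=
    t * objective D u + (1 - t) * objective D v.
  rewrite /objective !mulr_sumr -big_split/=; apply: ler_sum => d _.
  by apply: convex_functionE => //; exact: fconv.
lra.
Qed.

Lemma exists_saddle x : optimal D x -> exists y, saddle x y.
Proof.
move=> [xfeas xopt].
have res0 : forall d, residual x d = 0.
  move=> d; have [Dd|/ydim0] := ltnP d.+1 D; last exact: col_dim0.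
  by rewrite /residual xfeas// subrr.
suff [lam lamP] : exists lam : dual_space P, forall w,
    (forall d, (D.-1 <= d)%N -> residual w d = 0) ->
    \sum_(d < D.-1) dotv (lam d) (residual w d) <= objective D w - objective D x.
  (* [vector_multiplier] bounds the pairing above by the objective gap, whereas [saddle] adds the
     pairing to the objective; hence the sign change. *)
  exists (fun d => - lam d); split => // w.
  under eq_bigr do rewrite dotvNl.
  rewrite sumrN; have := lamP w; rewrite lerBrDr addrC lerBrDr; apply => d Dd.
  by apply: col_dim0; apply: ydim0; rewrite -(prednK D0).
(* Induction on the number [n] of constraints already dualised, those of index at least [n] being
   still imposed. With none dualised the claim is the optimality of [x]; each step dualises
   constraint [n] on the affine set cut out by the later ones. *)
elim: D.-1 => [|n [lam lamP]].
  exists (fun=> 0) => w w0; rewrite big_ord0 subr_ge0; apply: xopt => d _.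
  by apply/eqP; rewrite -subr_eq0; apply/eqP/w0.
have [a aP] : exists a, forall w : primal_space P,
    [set w : primal_space P | forall d, (n.+1 <= d)%N -> residual w d = 0] w ->
    dotv a (residual w n) <=
    objective D w - objective D x - \sum_(d < n) dotv (lam d) (residual w d).
  apply: (@vector_multiplier R _ primal_comb _ _ _ _ x) => //.
  - move=> t u v Wu Wv d nd.
    by rewrite residual_affine Wu// Wv// !scaler0 addr0.
  - move=> t u v t01; have := objective_convex x u v t01.
    under [X in _ -> _ - X <= _]eq_bigr do
      rewrite residual_affine dotvDr !dotvZr.
    rewrite big_split/= -!mulr_sumr; lra.
  - exact: residual_affine.
  - move=> w Ww w0; rewrite subr_ge0; apply: lamP => d.
    by rewrite leq_eqVlt => /predU1P[<-//|]; exact: Ww.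
exists (dfwith lam n a) => w Ww; rewrite big_ord_recr/= dfwithin.
rewrite -lerBrDl; under eq_bigr => d _ do rewrite dfwithout ?gtn_eqF//.
exact: aP.
Qed.

(** * Constraint pairings regrouped by level *)

Definition uplink q d : 'cV[R]_(xdim P d) :=
  match d with 0 => 0 | e.+1 => (BL P e)^T *m q e end.

Lemma eq_uplink q q' d : (forall e, (e < d)%N -> q e = q' e) ->
  uplink q d = uplink q' d.
Proof. by case: d => //= d /(_ d (ltnSn d)) ->. Qed.

(* - adj y d is the subgradient of f_d in the KKT conditions; at the last level
   the A-term vanishes because ydim is 0 there. *)
Definition adj q d : 'cV[R]_(xdim P d) := (AL P d)^T *m q d + uplink q d.

(** Summation by parts: level [d] occurs in constraint [d] through [A] and in constraint [d - 1]
    through [B]. At the ends, the root has no [B]-term and the multiplier of the last level lives in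
    dimension 0. *)
Lemma sum_adj q (v : primal_space P) :
  \sum_(e < D.-1) dotv (q e) (AL P e *m v e + BL P e *m v e.+1) =
  \sum_(d < D) dotv (adj q d) (v d).
Proof.
under eq_bigr do rewrite dotvDr !dotv_adjoint.
under [RHS]eq_bigr do rewrite dotvDl.
rewrite !big_split/=; move: D0 ydim0; case: D => // n _ y0 /=; congr (_ + _).
  rewrite big_ord_recr/= (_ : q n = 0) ?mulmx0 ?dotv0l ?addr0//.
  by apply: col_dim0; exact: y0.
by rewrite big_ord_recl/= dotv0l add0r.
Qed.

Lemma sum_AL q (v : primal_space P) :
  \sum_(d < D) dotv ((AL P d)^T *m q d) (v d) =
  \sum_(e < D.-1) dotv (q e) (AL P e *m v e).
Proof.
under [RHS]eq_bigr do rewrite dotv_adjoint.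
move: D0 ydim0; case: D => // n _ y0; rewrite big_ord_recr/=.
rewrite (_ : q n = 0) ?mulmx0 ?dotv0l ?addr0//.
by apply: col_dim0; exact: y0.
Qed.

Lemma lagrangianE rho x y : lagrangian D rho x y =
  objective D x + \sum_(e < D.-1)
    (dotv (y e) (residual x e) + rho / 2 * sqnorm2 (residual x e)).
Proof.
rewrite /lagrangian /objective; under eq_bigr do rewrite -addrA.
rewrite big_split/= addrA; congr (_ + _).
by case: D D0 => // n _; rewrite big_ord_recr/= addrC.
Qed.

Lemma residual_shift x (v : primal_space P) t e :
  residual (fun d => x d + t *: v d : 'cV_(xdim P d)) e =
  residual x e + t *: (AL P e *m v e + BL P e *m v e.+1).
Proof.
rewrite /residual !mulmxDr -!scalemxAr.
move: (AL P e *m x e) (AL P e *m v e) (BL P e *m x _) (BL P e *m v _).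
by move=> ? ? ? ?; apply/matrixP => i j; rewrite !mxE; ring.
Qed.

(** * Continuity of the KKT data, and the KKT conditions in variational form *)

Lemma cvg_primal (p : primal_space P * dual_space P) d :
  (q.1 d : 'cV[R]_(xdim P d)) @[q --> p] --> (p.1 d : 'cV[R]_(xdim P d)).
Proof.
apply: (@cvg_comp _ _ _ fst (proj d) _ (nbhs p.1)); first exact: cvg_fst.
exact: (@proj_continuous _ (fun d => 'cV[R]_(xdim P d)) d p.1).
Qed.

Lemma cvg_dual (p : primal_space P * dual_space P) d :
  (q.2 d : 'cV[R]_(ydim P d)) @[q --> p] --> (p.2 d : 'cV[R]_(ydim P d)).
Proof.
apply: (@cvg_comp _ _ _ snd (proj d) _ (nbhs p.2)); first exact: cvg_snd.
exact: (@proj_continuous _ (fun d => 'cV[R]_(ydim P d)) d p.2).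
Qed.

Lemma cvg_adj (p : primal_space P * dual_space P) d :
  adj q.2 d @[q --> p] --> adj p.2 d.
Proof.
apply: cvgD; first by apply: cvg_mulmx; exact: cvg_dual.
by case: d => [|d]; [exact: cvg_cst|apply: cvg_mulmx; exact: cvg_dual].
Qed.

Lemma cvg_residual (p : primal_space P * dual_space P) d :
  residual q.1 d @[q --> p] --> residual p.1 d.
Proof.
apply: cvgB; last exact: cvg_cst.
by apply: cvgD; apply: cvg_mulmx; exact: cvg_primal.
Qed.

(** The three stationarity conditions all say that [- adj] is a subgradient; they differ only in
    which term of [adj] vanishes. This uniform form passes to limits. *)
Lemma kkt_variational (p : primal_space P * dual_space P) : (1 < D)%N ->
  (forall d, (d < D)%N -> forall w : 'cV[R]_(xdim P d),
    fL (p.1 d) <= fL w + dotv (adj p.2 d) (w - p.1 d)) ->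
  (forall d, residual p.1 d = 0) -> kkt_set D P p.
Proof.
move=> D1 stat feas.
have sub d : (d < D)%N -> subdifferential (@fL R P d) (p.1 d) (- adj p.2 d).
  by move=> dD w; rewrite dotvNl lerBlDr; exact: stat.
split.
- exists (- adj p.2 0); first exact: sub.
  by rewrite /adj/= addr0 addNr.
- move=> d dD; exists (- adj p.2 d.+1); first by apply: sub; rewrite -dD.
  rewrite /adj/= (_ : p.2 d.+1 = 0) ?mulmx0 ?add0r ?addNr//.
  by apply: col_dim0; apply: ydim0; rewrite -dD.
- move=> d dD; exists (- adj p.2 d.+1); first by apply: sub; exact: ltnW.
  by rewrite /adj/= -addrA addNr.
- by move=> d _; apply/eqP; rewrite -subr_eq0; apply/eqP; exact: feas.
Qed.

(** * First-order conditions of the hADMM updates *)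

Section Iteration.
Variables (rho : R) (z : nat -> primal_space P * dual_space P).
Hypothesis hz : hadmm D rho z.

Local Notation x k := (z k).1.
Local Notation y k := (z k).2.
Local Notation r k d := (residual (x k) d).
Local Notation b k d := (BL P d *m (x k.+1 d.+1 - x k d.+1)).

Lemma dual_step k d : y k.+1 d = y k d + rho *: r k.+1 d.
Proof.
have [/(proj2 (hz k))//|/ydim0] := ltnP d.+1 D; exact: col_dim0.
Qed.

(** [- force k d] is the subgradient of the level cost selected by the primal update. The correction
    to [adj] appears because level [d] is minimised against the old [x_(d+1)], while the dual step
    uses the new one. *)
Definition force k d : 'cV[R]_(xdim P d) :=
  adj (y k.+1) d - (AL P d)^T *m (rho *: b k d).

(** On the line through [x k.+1 d] and [w], the Lagrangian is the level cost plus a quadratic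
    polynomial in [t]; [convex_min_linearized] keeps only its linear term. *)
Lemma stationary k d (w : 'cV[R]_(xdim P d)) : (d < D)%N ->
  fL (x k.+1 d) <= fL w + dotv (force k d) (w - x k.+1 d).
Proof.
move=> dD.
pose s (w : 'cV_(xdim P d)) := sweep (x k.+1) (x k) w.
pose v : primal_space P := dfwith (fun e => 0 : 'cV_(xdim P e)) d (w - x k.+1 d).
set x0 := s (x k.+1 d).
have sE t : s (x k.+1 d + t *: (w - x k.+1 d)) =
    (fun e => x0 e + t *: v e : 'cV_(xdim P e)) :> primal_space P.
  apply: functional_extensionality_dep => e; rewrite /x0 /s /sweep /v.
  have [<-|de] := eqVneq d e; first by rewrite !dfwithin.
  by rewrite !dfwithout// scaler0 addr0.
pose C := \sum_(e < D | e != Ordinal dD) fL (x0 e).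
have objE t : objective D (s (x k.+1 d + t *: (w - x k.+1 d))) =
    fL (x k.+1 d + t *: (w - x k.+1 d)) + C.
  rewrite /objective (bigD1 (Ordinal dD))//= {1}/s /sweep dfwithin; congr (_ + _).
  apply: eq_bigr => e ed; rewrite sE /v dfwithout ?scaler0 ?addr0// eq_sym.
  by apply: contra_neq ed => ed; exact: val_inj.
(* Derivative of the augmented Lagrangian with respect to residual [e], at the sweep point. *)
pose q e : 'cV_(ydim P e) := y k e + rho *: residual x0 e.
pose u e := AL P e *m v e + BL P e *m v e.+1.
have LE t : lagrangian D rho (s (x k.+1 d + t *: (w - x k.+1 d))) (y k) =
    fL (x k.+1 d + t *: (w - x k.+1 d)) + t * dotv (adj q d) (w - x k.+1 d)
    + t ^+ 2 * (\sum_(e < D.-1) rho / 2 * sqnorm2 (u e))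
    + (C + \sum_(e < D.-1) (dotv (y k e) (residual x0 e)
                            + rho / 2 * sqnorm2 (residual x0 e))).
  rewrite lagrangianE objE sE.
  have -> : dotv (adj q d) (w - x k.+1 d) = \sum_(e < D.-1) dotv (q e) (u e).
    rewrite sum_adj (bigD1 (Ordinal dD))//= /v dfwithin big1 ?addr0// => e ed.
    rewrite dfwithout ?dotv0r// eq_sym.
    by apply: contra_neq ed => ed; exact: val_inj.
  rewrite addrACA -!addrA; congr (_ + _); rewrite !mulr_sumr addrCA; congr (_ + _).
  rewrite -!big_split/=; apply: eq_bigr => e _.
  rewrite residual_shift -/(u e) /sqnorm2 /q.
  move: (residual x0 e) (u e) => res ue; rewrite !dotvP [dotv ue res]dotvC.
  by field.
(* At the sweep point, residual [d] mixes the new [x_d] with the old [x_(d+1)], so [q d] is the new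
   multiplier minus [rho *: b k d]. Residuals below [d] involve only new blocks and give the new
   multiplier itself. *)
have adjE : adj q d = force k d.
  rewrite /force /adj addrAC -mulmxBr; congr (_ *m _ + _).
    rewrite /q dual_step -addrA; congr (_ + _).
    rewrite -scalerBr; congr (_ *: _).
    rewrite /residual /x0 /s /sweep dfwithin dfwithout ?ltn_eqF// ltnNge leqnSn/=.
    rewrite mulmxBr; move: (AL P d *m _) (BL P d *m _) (BL P d *m _) => ? ? ?.
    by apply/matrixP => i j; rewrite !mxE; ring.
  apply: eq_uplink => e ed; rewrite dual_step; congr (_ + _ *: _).
  rewrite /residual /x0 /s /sweep (dfwithout _ _ (negbT (gtn_eqF ed))) ed.
  congr (_ + _ *m _ - _).
  have [->|de] := eqVneq d e.+1; first by rewrite dfwithin.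
  by rewrite dfwithout// ltn_neqAle eq_sym de ed.
have -> : fL w = fL (x k.+1 d + (w - x k.+1 d)) by rewrite subrKC.
rewrite -adjE; apply: (convex_min_linearized
  (b := \sum_(e < D.-1) rho / 2 * sqnorm2 (u e))) => [|t]; first exact: fconv.
have [/(_ d dD) /(_ (x k.+1 d + t *: (w - x k.+1 d))) + _] := hz k.
rewrite -/(s _) -/(s _) LE; have := LE 0; rewrite scale0r addr0 => ->.
by rewrite !mul0r expr0n mul0r !addr0; lra.
Qed.

(** * Fejer monotonicity and vanishing residuals *)

Section Fejer.
Hypothesis rho0 : 0 < rho.
Variables (xs : primal_space P) (ys : dual_space P).
Hypothesis xys : saddle xs ys.

Definition lyapunov k : R := \sum_(e < D.-1)
  (sqnorm2 (y k e - ys e) + rho ^+ 2 * sqnorm2 (BL P e *m (x k e.+1 - xs e.+1))).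

Lemma lyapunov_decrease k :
  lyapunov k.+1 + rho ^+ 2 * (\sum_(e < D.-1) sqnorm2 (r k.+1 e - b k e))
  <= lyapunov k.
Proof.
pose v : primal_space P := fun d => xs d - x k.+1 d.
have stat : objective D (x k.+1) <=
    objective D xs + \sum_(d < D) dotv (force k d) (v d).
  by rewrite /objective -big_split/=; apply: ler_sum => d _; exact: stationary.
(* Feasibility of [xs] expresses the [A]-part through the residual and the [B]-part, so that every
   term belongs to a single constraint. *)
have Av e : AL P e *m v e = BL P e *m (x k.+1 e.+1 - xs e.+1) - r k.+1 e.
  have := xys.1 e; rewrite /residual /v !mulmxBr.
  move: (AL P e *m xs e) (BL P e *m xs _) (AL P e *m _) (BL P e *m _).
  move=> a a' c c' /eqP; rewrite subr_eq0 => /eqP <-.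
  by apply/matrixP => i j; rewrite !mxE; ring.
have Bv e : BL P e *m v e.+1 = - (BL P e *m (x k.+1 e.+1 - xs e.+1)).
  by rewrite -mulmxN opprB.
have := xys.2 (x k.+1); rewrite -subr_ge0 => sad.
(* Adding stationarity tested at [xs] to the saddle inequality at [x k.+1] cancels the
   objectives. *)
have key : 0 <= \sum_(e < D.-1) (rho * dotv (b k e)
    (r k.+1 e - BL P e *m (x k.+1 e.+1 - xs e.+1))
    - dotv (y k.+1 e - ys e) (r k.+1 e)).
  have -> : \sum_(e < D.-1) (rho * dotv (b k e)
      (r k.+1 e - BL P e *m (x k.+1 e.+1 - xs e.+1))
      - dotv (y k.+1 e - ys e) (r k.+1 e)) =
    \sum_(d < D) dotv (force k d) (v d)
    + \sum_(e < D.-1) dotv (ys e) (r k.+1 e); last lra.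
  under [X in _ = X + _]eq_bigr do rewrite dotvDl -mulmxN -scalerN.
  rewrite [in RHS]big_split/= -sum_adj (sum_AL (fun d => rho *: - b k d)).
  rewrite -!big_split/=; apply: eq_bigr => e _.
  rewrite Av Bv; move: (r _ _) (BL P e *m (_ - xs _)) (b k e) => s U c.
  by rewrite !dotvP; ring.
rewrite -subr_ge0 mulr_sumr opprD addrA /lyapunov -!sumrB.
have -> : \sum_(e < D.-1)
    (sqnorm2 (y k e - ys e)
     + rho ^+ 2 * sqnorm2 (BL P e *m (x k e.+1 - xs e.+1))
     - (sqnorm2 (y k.+1 e - ys e)
        + rho ^+ 2 * sqnorm2 (BL P e *m (x k.+1 e.+1 - xs e.+1)))
     - rho ^+ 2 * sqnorm2 (r k.+1 e - b k e)) =
  \sum_(e < D.-1) 2 * rho * (rho * dotv (b k e)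
    (r k.+1 e - BL P e *m (x k.+1 e.+1 - xs e.+1))
    - dotv (y k.+1 e - ys e) (r k.+1 e)).
  apply: eq_bigr => e _; rewrite -lyapunov_identity; congr (_ + _ * _ - _ - _).
    rewrite dual_step; congr sqnorm2.
    by move: (r _ _) => s; apply/matrixP => i j; rewrite !mxE; ring.
  rewrite -mulmxBr; congr (sqnorm2 (_ *m _)).
  by apply/matrixP => i j; rewrite !mxE; ring.
by rewrite -mulr_sumr mulr_ge0// mulr_ge0// ltW.
Qed.

Lemma lyapunov_ge0 k : 0 <= lyapunov k.
Proof.
apply: sumr_ge0 => e _.
apply: addr_ge0; first exact: sqnorm2_ge0.
by apply: mulr_ge0; [exact: sqr_ge0|exact: sqnorm2_ge0].
Qed.

Lemma lyapunov_nonincreasing k : lyapunov k.+1 <= lyapunov k.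
Proof.
apply: le_trans (lyapunov_decrease k); rewrite lerDl mulr_ge0 ?sqr_ge0//.
by apply: sumr_ge0 => e _; exact: sqnorm2_ge0.
Qed.

Lemma lyapunov_le0 k : lyapunov k <= lyapunov 0.
Proof. by elim: k => // k; exact: le_trans (lyapunov_nonincreasing k). Qed.

(** [lyapunov] decreases and is nonnegative, hence converges; its decrements tend to 0 and dominate
    the squared gaps. *)
Lemma gap_cvg0 d : r k.+1 d - b k d @[k --> \oo] --> (0 : 'cV[R]_(ydim P d)).
Proof.
have [dD|/ydim0 y0] := ltnP d.+1 D; last exact: cvg_dim0.
have dD1 : (d < D.-1)%N by rewrite -ltnS (prednK D0).
have /cvg_ex[l Vl] : cvgn lyapunov.
  apply: nonincreasing_is_cvgn.
    by apply/nonincreasing_seqP => k; exact: lyapunov_nonincreasing.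
  by exists 0 => _ [k _ <-]; exact: lyapunov_ge0.
have dV0 : (lyapunov k - lyapunov k.+1) / rho ^+ 2 @[k --> \oo] --> (0 : R).
  rewrite -(mul0r (rho ^+ 2)^-1) -(subrr l).
  apply: cvgM; last exact: cvg_cst.
  by apply: cvgB => //; rewrite (cvg_shiftS lyapunov).
apply: cvg_sqnorm2_0; apply: squeeze_cvgr (@cvg_cst _ 0 _ \oo _) dV0.
apply: nearW => k; rewrite sqnorm2_ge0/= ler_pdivlMr ?exprn_gt0//.
rewrite lerBrDl; apply: le_trans (lyapunov_decrease k).
rewrite lerD2l mulrC ler_wpM2l ?sqr_ge0// (bigD1 (Ordinal dD1))//= lerDl.
by apply: sumr_ge0 => e _; exact: sqnorm2_ge0.
Qed.

Lemma force_monotone k d : (d.+1 < D)%N ->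
  dotv (b k.+1 d) (r k.+2 d) <=
  - dotv (r k.+2 d.+1 - r k.+1 d.+1 - b k.+1 d.+1)
         (r k.+2 d.+1 - b k.+1 d.+1 + b k d.+1).
Proof.
move=> dD; set dx := x k.+2 d.+1 - x k.+1 d.+1.
have Adx : r k.+2 d.+1 - r k.+1 d.+1 - b k.+1 d.+1 = AL P d.+1 *m dx.
  rewrite /residual /dx !mulmxBr.
  move: (AL P d.+1 *m _) (BL P d.+1 *m _) (AL P d.+1 *m _) (BL P d.+1 *m _).
  by move=> ? ? ? ?; apply/matrixP => i j; rewrite !mxE; ring.
(* The dual step replaces differences of consecutive multipliers by residuals, so no multiplier
   remains. Paired with [dx], the [B]-part becomes the product of [b k.+1 d] and [r k.+2 d]. *)
have forceE : force k.+1 d.+1 - force k d.+1 =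
    (AL P d.+1)^T *m (rho *: (r k.+2 d.+1 - b k.+1 d.+1 + b k d.+1))
    + (BL P d)^T *m (rho *: r k.+2 d).
  rewrite /force /adj/= !(dual_step k.+1).
  move: (y k.+1 d.+1) (y k.+1 d) (r _ d.+1) (r _ d) (b k.+1 _) (b k d.+1).
  move=> a a' s s' c c'; rewrite !scalerDr !scalerN !mulmxDr !mulmxN.
  move: (_ *m a) (_ *m a') (_ *m (rho *: s)) (_ *m (rho *: s')).
  move: (_ *m (rho *: c)) (_ *m (rho *: c')) => ? ? ? ? ? ?.
  by apply/matrixP => i j; rewrite !mxE; ring.
(* Each of two consecutive iterates is tested at the other; the sum eliminates the cost values. *)
have := stationary k.+1 (x k.+1 d.+1) dD; have := stationary k (x k.+2 d.+1) dD.
have -> : x k.+1 d.+1 - x k.+2 d.+1 = - dx by rewrite opprB.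
rewrite -/dx => h1 h2.
have : dotv (force k.+1 d.+1 - force k d.+1) dx <= 0.
  move: h1 h2; rewrite dotvNr.
  move: (fL (x k.+1 _)) (fL (x k.+2 _)) (force k.+1 _) (force k _).
  by move=> ? ? ? ?; rewrite dotvDl dotvNl; lra.
rewrite forceE => hm; rewrite dotvDl -!dotv_adjoint -Adx !dotvZl in hm.
rewrite -mulrDr pmulr_rle0// in hm.
by rewrite [dotv (_ - _ - _) _]dotvC [dotv (b _ _) _]dotvC; lra.
Qed.

Lemma residual_step_cvg0 d :
  r k.+1 d @[k --> \oo] --> (0 : 'cV[R]_(ydim P d)) /\
  b k d @[k --> \oo] --> (0 : 'cV[R]_(ydim P d)).
Proof.
(* [n] bounds the distance from level [d] to [D], so the induction runs from the last level up to
   the root. *)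
suff H n : forall d, (D <= d + n)%N ->
    r k.+1 d @[k --> \oo] --> (0 : 'cV[R]_(ydim P d)) /\
    b k d @[k --> \oo] --> (0 : 'cV[R]_(ydim P d)).
  by apply: (H D); rewrite leq_addl.
elim: n => [|n IH] {}d dn.
  have y0 : ydim P d = 0%N by apply: ydim0; rewrite leqW// -(addn0 d).
  by split; exact: cvg_dim0.
have [dD|/ydim0 y0] := ltnP d.+1 D; last first.
  by split; exact: cvg_dim0.
have [r0 b0] : r k.+1 d.+1 @[k --> \oo] --> (0 : 'cV[R]_(ydim P d.+1)) /\
    b k d.+1 @[k --> \oo] --> (0 : 'cV[R]_(ydim P d.+1)).
  by apply: IH; rewrite addSnnS.
have r0' : r k.+2 d.+1 @[k --> \oo] --> (0 : 'cV[R]_(ydim P d.+1)).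
  by rewrite (cvg_shiftS (fun k => r k.+1 d.+1)).
have b0' : b k.+1 d.+1 @[k --> \oo] --> (0 : 'cV[R]_(ydim P d.+1)).
  by rewrite (cvg_shiftS (fun k => b k d.+1)).
have err0 : 2 * - dotv (r k.+2 d.+1 - r k.+1 d.+1 - b k.+1 d.+1)
    (r k.+2 d.+1 - b k.+1 d.+1 + b k d.+1) @[k --> \oo] --> (0 : R).
  have -> : (0 : R) = 2 * - dotv (0 : 'cV[R]_(ydim P d.+1)) 0.
    by rewrite dotv0l oppr0 mulr0.
  apply: cvgM; first exact: cvg_cst.
  apply: cvgN; apply: cvg_dotv; first exact: cvg0B (cvg0B r0' r0) b0'.
  exact: cvg0D (cvg0B r0' b0') b0.
have gap0 : sqnorm2 (r k.+2 d - b k.+1 d) @[k --> \oo] --> (0 : R).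
  rewrite (cvg_shiftS (fun k => sqnorm2 (r k.+1 d - b k d))).
  have := cvg_dotv (gap_cvg0 (d := d)) (gap_cvg0 (d := d)).
  by rewrite dotv0l; exact.
set err := fun k => 2 * - dotv _ _ in err0.
have sum0 : sqnorm2 (r k.+2 d - b k.+1 d) + err k @[k --> \oo] --> (0 : R).
  by have := cvgD gap0 err0; rewrite addr0; exact.
(* Polarisation: the left side is the squared gap plus twice the inner product of [b] and [r], which
   [force_monotone] bounds by terms of level [d.+1] only. *)
have bnd k : sqnorm2 (r k.+2 d) + sqnorm2 (b k.+1 d) <=
    sqnorm2 (r k.+2 d - b k.+1 d) + err k.
  have := force_monotone k dD; rewrite /err; move: (- dotv _ _) => e.
  move: (r k.+2 d) (b k.+1 d) => s c.
  by rewrite /sqnorm2 !dotvP [dotv s c]dotvC; lra.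
have r0s : sqnorm2 (r k.+2 d) @[k --> \oo] --> (0 : R).
  apply: squeeze_cvgr (@cvg_cst _ 0 _ \oo _) sum0.
  apply: nearW => k; rewrite sqnorm2_ge0/=; apply: le_trans (bnd k).
  by rewrite lerDl sqnorm2_ge0.
have b0s : sqnorm2 (b k.+1 d) @[k --> \oo] --> (0 : R).
  apply: squeeze_cvgr (@cvg_cst _ 0 _ \oo _) sum0.
  apply: nearW => k; rewrite sqnorm2_ge0/=; apply: le_trans (bnd k).
  by rewrite lerDr sqnorm2_ge0.
split.
  by rewrite -(cvg_shiftS (fun k => r k.+1 d)); exact: cvg_sqnorm2_0 r0s.
by rewrite -(cvg_shiftS (fun k => b k d)); exact: cvg_sqnorm2_0 b0s.
Qed.

Lemma residual_cvg0 d : r k d @[k --> \oo] --> (0 : 'cV[R]_(ydim P d)).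
Proof. by rewrite -(cvg_shiftS (fun k => r k d)); exact: (residual_step_cvg0 d).1. Qed.

(** * Boundedness, cluster points and convergence under full rank *)

Section FullRank.
Hypothesis D1 : (1 < D)%N.
Hypothesis rankA : \rank (AL P 0) = xdim P 0.
Hypothesis rankB : forall d, (d.+1 < D)%N -> \rank (BL P d) = xdim P d.+1.
Hypothesis flsc : forall d, (d < D)%N ->
  lower_semicontinuous (EFin \o @fL R P d).

Lemma bounded_terms e : (e.+1 < D)%N ->
  bounded_seq (fun k => y k e - ys e) /\
  bounded_seq (fun k => BL P e *m (x k e.+1 - xs e.+1)).
Proof.
move=> eD; have eD1 : (e < D.-1)%N by rewrite -ltnS (prednK D0).
have term k : sqnorm2 (y k e - ys e)
    + rho ^+ 2 * sqnorm2 (BL P e *m (x k e.+1 - xs e.+1)) <= lyapunov 0.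
  apply: le_trans (lyapunov_le0 k); rewrite /lyapunov (bigD1 (Ordinal eD1))//=.
  rewrite lerDl; apply: sumr_ge0 => i _; apply: addr_ge0; first exact: sqnorm2_ge0.
  by apply: mulr_ge0; [exact: sqr_ge0|exact: sqnorm2_ge0].
have rho2 : 0 < rho ^+ 2 by exact: exprn_gt0.
split.
  apply: (@bounded_seq_sqnorm2 _ _ _ (lyapunov 0)) => k.
  by apply: le_trans (term k); rewrite lerDl mulr_ge0 ?sqnorm2_ge0// ltW.
apply: (@bounded_seq_sqnorm2 _ _ _ (lyapunov 0 / rho ^+ 2)) => k.
rewrite ler_pdivlMr// mulrC; apply: le_trans (term k).
by rewrite lerDr sqnorm2_ge0.
Qed.

Lemma bounded_dual e : bounded_seq (fun k => y k e).
Proof.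
have [eD|/ydim0] := ltnP e.+1 D; last exact: bounded_seq_dim0.
have := bounded_seqD (bounded_terms eD).1 (bounded_seq_cst (ys e)).
by under eq_fun do rewrite subrK.
Qed.

(** By the dual step, the residual is [rho^-1] times an increment of the bounded multipliers. *)
Lemma bounded_residual e : bounded_seq (fun k => r k.+1 e).
Proof.
have /(bounded_seqZ rho^-1) : bounded_seq (fun k => y k.+1 e - y k e).
  apply: bounded_seqB (bounded_dual e).
  by have [M yM] := bounded_dual e; exists M => k; exact: yM.
under eq_fun do rewrite dual_step addrAC subrr add0r scalerA mulVf ?gt_eqF// scale1r.
exact.
Qed.

Lemma bounded_primal d : (d < D)%N -> bounded_seq (fun k => x k d).
Proof.
have down e : (e.+1 < D)%N -> bounded_seq (fun k => x k e.+1).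
  move=> eD; have := bounded_seq_full_rank (rankB eD) (bounded_terms eD).2.
  move=> /bounded_seqD/(_ (bounded_seq_cst (xs e.+1))).
  by under eq_fun do rewrite subrK.
case: d => [_|d dD]; last exact: down.
(* The root block is recovered from constraint 0, as [A x_0 = r - B x_1 + c]; the residual bound
   starts at iterate 1, hence the shift. *)
apply: bounded_seq_shift; apply: (bounded_seq_full_rank rankA).
have Bx : bounded_seq (fun k => BL P 0 *m x k.+1 1%N).
  have [M xM] := bounded_seq_mulmx (BL P 0) (down 0%N D1).
  by exists M => k; exact: xM.
have := bounded_seqD (bounded_seqB (bounded_residual 0) Bx)
                     (bounded_seq_cst (cL P 0)).
congr bounded_seq; apply/funext => k; rewrite /residual.
move: (AL P 0 *m _) (BL P 0 *m _) => ? ?.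
by apply/matrixP => i j; rewrite !mxE; ring.
Qed.

Lemma bounded_iterates : exists M, forall k,
  (forall d, (d < D)%N -> `|x k d| <= M) /\
  (forall d, (d.+1 < D)%N -> `|y k d| <= M).
Proof.
have bx d : exists M, (d < D)%N -> forall k, `|x k d| <= M.
  have [/bounded_primal[M xM]|_] := ltnP d D; first by exists M.
  by exists 0.
have [Mx xM] := choice bx.
have [My yM] := choice (fun e => bounded_dual e).
(* Summing the separate bounds over the finitely many levels gives one bound for all blocks. *)
exists (\sum_(d < D) (`|Mx d| + `|My d|)) => k.
have le_sum d : (d < D)%N ->
    `|Mx d| + `|My d| <= \sum_(d < D) (`|Mx d| + `|My d|).
  move=> dD; rewrite (bigD1 (Ordinal dD))//= lerDl.
  by apply: sumr_ge0 => e _; exact: addr_ge0.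
split => d dD.
  apply: le_trans (le_sum d dD); apply: le_trans (xM d dD k) _.
  by rewrite (le_trans (ler_norm _))// lerDl.
apply: le_trans (le_sum d (ltnW dD)); apply: le_trans (yM d k) _.
by rewrite (le_trans (ler_norm _))// lerDr.
Qed.

Lemma cluster_kkt : cluster (z @ \oo) `<=` kkt_set D P.
Proof.
move=> p clp; apply: kkt_variational => // d.
- move=> dD w; pose phi (q : primal_space P * dual_space P) : R :=
    fL (q.1 d) - (fL w + dotv (adj q.2 d) (w - q.1 d)).
  rewrite -subr_le0 -/(phi p); apply: (cluster_le0 clp).
  (* Half of [phi p - a] is spent on the lower semicontinuity of the cost, half on the continuity of
     the pairing. *)
  + move=> a ap; set c := (phi p - a) / 2.
    have c0 : 0 < c by rewrite /c; lra.
    have [] := @flsc d dD (p.1 d) (fL (p.1 d) - c).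
      by rewrite /= lte_fin; lra.
    move=> U nU Uf; have pU : \forall q \near p, U (q.1 d) := cvg_primal nU.
    have gp : dotv (adj q.2 d) (w - q.1 d) @[q --> p] -->
        dotv (adj p.2 d) (w - p.1 d).
      apply: cvg_dotv; first exact: cvg_adj.
      by apply: cvgB; [exact: cvg_cst|exact: cvg_primal].
    have /cvgrPdist_lt/(_ _ c0) pg := gp.
    apply: filterS2 pU pg => q /Uf /=; rewrite lte_fin ltr_distl => fq /andP[gq _].
    rewrite /phi; move: ap gq fq; rewrite /c /phi; lra.
  + move=> e e0.
    (* By [stationary], [phi (z k.+1)] is at most the negative of this term, which vanishes because
       [b k d] does and [x] is bounded. *)
    have err0 : dotv (b k d) (rho *: (AL P d *m (w - x k.+1 d))) @[k --> \oo]
        --> (0 : R).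
      apply: cvg0_dotv_bounded; first exact: (residual_step_cvg0 d).2.
      apply: bounded_seqZ; apply: bounded_seq_mulmx.
      apply: bounded_seqB; first exact: bounded_seq_cst.
      have [M xM] := bounded_primal dD.
      by exists M => k; exact: xM.
    have : \forall k \near \oo, phi (z k.+1) <= e.
      have /cvgr0Pnorm_lt/(_ e e0) := err0; apply: filterS => k err.
      have := stationary k w dD; rewrite /phi /force dotvDl -mulmxN -dotv_adjoint.
      rewrite -scalerN dotvZl dotvNl => stat.
      have := ltr_normlP _ _ err; rewrite dotvZr => -[]; lra.
    by move=> [N _ NP]; exists N.+1 => // -[//|k] /= /NP.
- suff : sqnorm2 (residual p.1 d) <= 0.
    move=> r0; apply/matrixP => i j; rewrite ord1 [RHS]mxE.
    apply/eqP; rewrite -sqrf_eq0 eq_le sqr_ge0 andbT.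
    exact: le_trans (sqr_coord_le _ _) r0.
  pose phi (q : primal_space P * dual_space P) : R := sqnorm2 (residual q.1 d).
  rewrite -/(phi p); apply: (cluster_le0 clp).
  + move=> a ap; have cp : phi q @[q --> p] --> phi p.
      by apply: cvg_dotv; exact: cvg_residual.
    exact: cvgr_gt _ cp _ ap.
  + move=> e e0.
    have r0 : phi (z k) @[k --> \oo] --> (0 : R).
      have := cvg_dotv (residual_cvg0 (d := d)) (residual_cvg0 (d := d)).
      by rewrite dotv0l; exact.
    have /cvgr0Pnorm_lt/(_ e e0) := r0; apply: filterS => k.
    by rewrite ger0_norm ?sqnorm2_ge0// => /ltW.
Qed.

Lemma cvg_singleton_kkt (zstar : primal_space P * dual_space P) :
  (forall d, (D <= d)%N -> xdim P d = 0%N) ->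
  kkt_set D P = [set zstar] -> z @ \oo --> zstar.
Proof.
move=> xdim0 kkt1.
have [M zM] := bounded_iterates.
(* The boxes constrain every level of the infinite families, so Tychonoff applies; levels past the
   last have no coordinates, and the bounds on the finitely many blocks suffice. *)
pose Kx : set (primal_space P) := [set u | forall d i, `|u d i 0| <= M].
pose Ky : set (dual_space P) := [set v | forall d i, `|v d i 0| <= M].
apply: (@compact_cvg_cluster1 _ _ (Kx `*` Ky)).
- apply: compact_setX.
    exact: (tychonoff (fun d => @compact_coord_box R (xdim P d) M)).
  exact: (tychonoff (fun d => @compact_coord_box R (ydim P d) M)).
- exists 0%N => // k _; have [xM yM] := zM k; split => d i.
    have [dD|/xdim0 d0] := ltnP d D; last by have := ltn_ord i; rewrite {2}d0.
    exact: le_trans (coord_le_norm _ _) (xM d dD).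
  have [dD|/ydim0 d0] := ltnP d.+1 D; last by have := ltn_ord i; rewrite {2}d0.
  exact: le_trans (coord_le_norm _ _) (yM d dD).
- by rewrite -kkt1; exact: cluster_kkt.
Qed.

End FullRank.
End Fejer.
End Iteration.
End LayeredProblem.

Theorem theorem1 (R : realType) (D : nat) (hD : (2 <= D)%N) (T : tree D)
    (Q : tree_problem R T) (rho : R) (hrho : 0 < rho)
    (P := layered_form Q)
    (slater : exists x : primal_space P, strictly_feasible D x)
    (solvable : exists x : primal_space P, optimal D x)
    (hf : forall d, (d < D)%N ->
       [/\ proper_function (EFin \o @fL R P d),
           lower_semicontinuous (EFin \o @fL R P d)
         & @convex_function R 'cV[R]_(xdim P d) setT (@fL R P d)])
    (rankA : \rank (AL P 0%N) = xdim P 0%N)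
    (rankB : forall d, (d.+1 < D)%N -> \rank (BL P d) = xdim P d.+1)
    (z : nat -> primal_space P * dual_space P) (hz : hadmm D rho z) :
  [/\ exists M : R, forall k,
        (forall d, (d < D)%N -> `|(z k).1 d| <= M) /\
        (forall d, (d.+1 < D)%N -> `|(z k).2 d| <= M),
      forall d, (d.+1 < D)%N ->
        residual (z k).1 d @[k --> \oo] --> (0 : 'cV[R]_(ydim P d)),
      cluster (z @ \oo) `<=` kkt_set D P
    & forall zstar : primal_space P * dual_space P,
        kkt_set D P = [set zstar] -> z @ \oo --> zstar].
Proof.
have D0 : (0 < D)%N := ltnW hD.
have y0 d : (D <= d.+1)%N -> ydim P d = 0%N by exact: level_rows_eq0.
have fconv d : (d < D)%N -> @convex_function R 'cV[R]_(xdim P d) setT (@fL R P d).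
  by move=> /hf[].
have flsc d : (d < D)%N -> lower_semicontinuous (EFin \o @fL R P d).
  by move=> /hf[].
(* The optimal solution and its multipliers anchor the Lyapunov function behind all four
   conclusions. *)
have [xs /(exists_saddle D0 y0 fconv)[ys xys]] := solvable.
split.
- exact: (bounded_iterates D0 y0 fconv hz hrho xys hD rankA rankB).
- by move=> d _; exact: (residual_cvg0 D0 y0 fconv hz hrho xys).
- exact: (cluster_kkt D0 y0 fconv hz hrho xys hD rankA rankB flsc).
- move=> zstar.
  apply: (cvg_singleton_kkt D0 y0 fconv hz hrho xys hD rankA rankB flsc) => d.
  exact: level_dim_eq0.
Qed.
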